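(* Let $A_G=\bigoplus_{g\in G}A_g$ be a $G$-graded algebra over a field $\mathbb{F}$, let $M$ be a left $A_e$-module and let $\alpha\in B^2(G,\mathbb{F}^* )$ be a 2-coboundary. Then $M$ is restricted from $\alpha(A_G)$ if and only if it is restricted from $A_G$.
   Context: Algebras are associative and unital. A $G$-graded $\mathbb{F}$-algebra is $A_G=\bigoplus_{g\in G}A_g$ with $A_gA_h\subseteq A_{gh}$; $A_e$ is its base algebra. $B^2(G,\mathbb{F}^* )$ consists of the maps $\alpha(g,h)=\lambda_g\lambda_h\lambda_{gh}^{-1}$ with $\lambda_g\in\mathbb{F}^*$ ($g\in G$). For $\alpha\in Z^2(G,\mathbb{F}^* )$ (trivial action), $\mathbb{F}^{\alpha}G=\bigoplus_g\mathbb{F}v_g$, $v_gv_h=\alpha(g,h)v_{gh}$, and $\alpha(A_G)=\bigoplus_g\mathbb{F}v_g\otimes_{\mathbb{F}}A_g\subseteq\mathbb{F}^{\alpha}G\otimes_{\mathbb{F}}A_G$, whose base algebra is identified with $A_e$ via $x\mapsto1\otimes x$. An $A_e$-module $M$ is restricted from $A_G$ (resp. $\alpha(A_G)$) if it is the restriction to $A_e$ of some left $A_G$-module (resp. $\alpha(A_G)$-module). *)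

(* Defs.v *)
From HB Require Import structures.
From mathcomp Require Import all_boot all_algebra generic_quotient ring_quotient.
From mathcomp Require Import finmap boolp.
From mathcomp.multinomials Require Import monalg.

Set Implicit Arguments.
Unset Strict Implicit.
Unset Printing Implicit Defensive.

Import GRing.Theory.

Local Open Scope ring_scope.
Local Open Scope quotient_scope.

Section FreeLift.
Context (F : fieldType) (K : choiceType) (V : lmodType F).
Implicit Types (h : K -> V) (x y : {malg F[K]}).

Definition freelift h x : V := \sum_(k <- msupp x) x@_k *: h k.

Lemma freeliftEw (d : {fset K}) h x : (msupp x `<=` d)%fset ->
  freelift h x = \sum_(k <- d) x@_k *: h k.
Proof.
move=> le_d; rewrite /freelift (big_fset_incl _ le_d) //.
by move=> k _ /mcoeff_outdom ->; rewrite scale0r.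
Qed.

Lemma freelift_is_linear h : linear (freelift h).
Proof.
move=> c x y; pose d := (msupp (c *: x + y) `|` (msupp x `|` msupp y))%fset.
have sx : (msupp x `<=` d)%fset.
  by rewrite fsubsetU // fsubsetU ?orbT // fsubset_refl.
have sy : (msupp y `<=` d)%fset.
  by rewrite fsubsetU // fsubsetU ?orbT // fsubset_refl ?orbT.
have sxy : (msupp (c *: x + y) `<=` d)%fset by rewrite fsubsetUl.
rewrite !(@freeliftEw d) // scaler_sumr -big_split /=.
by apply: eq_bigr => k _; rewrite mcoeffD mcoeffZ scalerDl scalerA.
Qed.

HB.instance Definition _ h :=
  GRing.isLinear.Build F {malg F[K]} V *:%R (freelift h) (freelift_is_linear h).

Lemma freeliftU h c k : freelift h << c *g k >> = c *: h k.
Proof.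
by rewrite (freeliftEw _ msuppU_le) big_seq_fset1 mcoeffUU.
Qed.

Lemma malgUZ (c : F) (k : K) : << c *g k >> = c *: << k >> :> {malg F[K]}.
Proof.
by apply/malgP => k'; rewrite mcoeffZ !mcoeffU; case: eqP; rewrite ?mulr1 ?mulr0.
Qed.

Lemma malg_ind (P : {malg F[K]} -> Prop) :
  P 0 -> (forall c k x, P x -> P (c *: << k >> + x)) -> forall x, P x.
Proof.
move=> P0 PD x; rewrite [x]monalgE; elim: (msupp x : seq K) => [|k s IHs].
  by rewrite big_nil.
by rewrite big_cons malgUZ; apply: PD.
Qed.

End FreeLift.

Definition is_bilinear (F : fieldType) (U V W : lmodType F)
    (b : U -> V -> W) : Prop :=
  (forall v, linear (b^~ v)) /\ (forall u, linear (b u)).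

(* Unlike [algType F], this allows the zero algebra. *)
Record assocAlg (F : fieldType) := AssocAlg {
  alg_mod : lmodType F;
  alg_one : alg_mod;
  alg_mul : alg_mod -> alg_mod -> alg_mod;
  alg_bilinear : is_bilinear alg_mul;
  alg_mulA : associative alg_mul;
  alg_mul1 : left_id alg_one alg_mul;
  alg_mulr1 : right_id alg_one alg_mul
}.

Definition alg_sort (F : fieldType) (A : assocAlg F) : Type := alg_mod A.
Coercion alg_sort : assocAlg >-> Sortclass.

Section AlgTheory.
Context (F : fieldType) (A : assocAlg F).

HB.instance Definition _ := GRing.Lmodule.copy (alg_sort A) (alg_mod A).

Let mulDl : left_distributive (@alg_mul F A) +%R.
Proof. by move=> x y z; have := (alg_bilinear A).1 z 1 x y; rewrite !scale1r. Qed.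

Let mulDr : right_distributive (@alg_mul F A) +%R.
Proof. by move=> z x y; have := (alg_bilinear A).2 z 1 x y; rewrite !scale1r. Qed.

HB.instance Definition _ := GRing.Zmodule_isPzRing.Build (alg_sort A)
  (@alg_mulA F A) (@alg_mul1 F A) (@alg_mulr1 F A) mulDl mulDr.

Lemma algZl (c : F) (x y : A) : (c *: x) * y = c *: (x * y).
Proof.
have : (c *: x + 0) * y = c *: (x * y) + 0 * y := (alg_bilinear A).1 y c x 0.
by rewrite mul0r !addr0.
Qed.

Lemma algZr (c : F) (x y : A) : x * (c *: y) = c *: (x * y).
Proof.
have : x * (c *: y + 0) = c *: (x * y) + x * 0 := (alg_bilinear A).2 x c y 0.
by rewrite mulr0 !addr0.
Qed.

End AlgTheory.

Bind Scope ring_scope with alg_sort.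

(* The tensor product of two vector spaces: the quotient of the free vector  *)
(* space on U * V by the smallest subspace containing the bilinearity        *)
(* relations.                                                                *)
Section Tensor.
Context (F : fieldType) (U V : lmodType F).
Local Notation free := {malg F[(U * V)%type]}.

Definition tensor_rel : {pred free} := fun x => `[< forall W : free -> Prop,
  W 0 -> (forall c y z, W y -> W z -> W (c *: y + z)) ->
  (forall c u u' v,
    W (<< (c *: u + u', v) >> - (c *: << (u, v) >> + << (u', v) >>))) ->
  (forall c u v v',
    W (<< (u, c *: v + v') >> - (c *: << (u, v) >> + << (u, v') >>))) ->
  W x >].

Lemma tensor_relZD c x y :
  x \in tensor_rel -> y \in tensor_rel -> c *: x + y \in tensor_rel.
Proof.
move=> /asboolP Hx /asboolP Hy; apply/asboolP => W W0 WD W1 W2.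
exact: (WD _ _ _ (Hx W W0 WD W1 W2) (Hy W W0 WD W1 W2)).
Qed.

Lemma tensor_rel0 : 0 \in tensor_rel.
Proof. by apply/asboolP => W W0 _ _ _; exact: W0. Qed.

Lemma tensor_rel_zmod : zmod_closed tensor_rel.
Proof.
split=> [|x y xr yr]; first exact: tensor_rel0.
by rewrite addrC -scaleN1r; apply: tensor_relZD.
Qed.

HB.instance Definition _ :=
  GRing.isZmodClosed.Build free tensor_rel tensor_rel_zmod.

Definition tensor : Type := Quotient.quot tensor_rel.

HB.instance Definition _ := GRing.Zmodule.on tensor.

Definition tpi (x : free) : tensor := \pi_(Quotient.quot tensor_rel) x.

Definition trepr (t : tensor) : free := repr (t : Quotient.quot tensor_rel).

Lemma treprK t : tpi (trepr t) = t.
Proof. exact: reprK. Qed.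

Lemma tpi_eq x y : (tpi x = tpi y) <-> (x - y \in tensor_rel).
Proof. by rewrite Quotient.idealrBE; split=> [/eqP|/eqP]. Qed.

Lemma tpiD x y : tpi (x + y) = tpi x + tpi y.
Proof. exact: Quotient.pi_add. Qed.

Definition tscale (c : F) (t : tensor) : tensor := tpi (c *: trepr t).

Lemma tscale_pi c x : tscale c (tpi x) = tpi (c *: x).
Proof.
apply/tpi_eq; rewrite -scalerBr -[_ *: _]addr0; apply: tensor_relZD.
  by apply/tpi_eq; rewrite treprK.
exact: tensor_rel0.
Qed.

Lemma tscaleA c d t : tscale c (tscale d t) = tscale (c * d) t.
Proof. by rewrite -[t]treprK !tscale_pi scalerA. Qed.

Lemma tscale1 : left_id 1 tscale.
Proof. by move=> t; rewrite -[t]treprK tscale_pi scale1r. Qed.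

Lemma tscaleDr : right_distributive tscale +%R.
Proof.
move=> c s t; rewrite -[s]treprK -[t]treprK -tpiD !tscale_pi.
by rewrite scalerDr tpiD.
Qed.

Lemma tscaleDl t : {morph tscale^~ t : c d / c + d}.
Proof. by move=> c d; rewrite /= -[t]treprK !tscale_pi scalerDl tpiD. Qed.

HB.instance Definition _ := GRing.Zmodule_isLmodule.Build F tensor
  tscaleA tscale1 tscaleDr tscaleDl.

Lemma tpi_is_linear : linear tpi.
Proof. by move=> c x y; rewrite tpiD -tscale_pi. Qed.

HB.instance Definition _ :=
  GRing.isLinear.Build F free tensor *:%R tpi tpi_is_linear.

Fact tens_key : unit. Proof. by []. Qed.

Definition tens : U -> V -> tensor :=
  locked_with tens_key (fun u v => tpi << (u, v) >>).

Lemma tensE u v : tens u v = tpi << (u, v) >>.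
Proof. by rewrite /tens unlock. Qed.

Lemma tens_bilinear : is_bilinear tens.
Proof.
split=> [v c u u'|u c v v']; rewrite !tensE -linearP; apply/tpi_eq.
  by apply/asboolP=> W _ _ W1 _; apply: W1.
by apply/asboolP=> W _ _ _ W2; apply: W2.
Qed.

HB.instance Definition _ u :=
  GRing.isLinear.Build F V tensor *:%R (tens u) (tens_bilinear.2 u).

Lemma tens_linearl c u u' v :
  tens (c *: u + u') v = c *: tens u v + tens u' v.
Proof. exact: tens_bilinear.1. Qed.

Lemma tens_ind (P : tensor -> Prop) :
  P 0 -> (forall u v t, P t -> P (tens u v + t)) -> forall t, P t.
Proof.
move=> P0 PD t; rewrite -[t]treprK; elim/malg_ind: (trepr t) => [|c [u v] x Px].
  by rewrite linear0.
rewrite linearP /= -tensE.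
have -> : c *: tens u v = tens u (c *: v) by rewrite linearZ.
exact: PD.
Qed.

Definition tlift (W : lmodType F) (b : U -> V -> W) (t : tensor) : W :=
  freelift (fun p => b p.1 p.2) (trepr t).

Section Lift.
Context (W : lmodType F) (b : U -> V -> W) (bb : is_bilinear b).

Lemma tlift_pi x : tlift b (tpi x) = freelift (fun p => b p.1 p.2) x.
Proof.
apply/subr0_eq; rewrite /tlift -linearB.
have /tpi_eq/asboolP H := treprK (tpi x).
apply: (H (fun y => freelift (fun p => b p.1 p.2) y = 0)) => [|c y z Hy Hz|c u u' v|c u v v'].
- by rewrite linear0.
- by rewrite linearP /= Hy Hz scaler0 addr0.
- by rewrite linearB linearP /= !freeliftU !scale1r /= bb.1 subrr.
- by rewrite linearB linearP /= !freeliftU !scale1r /= bb.2 subrr.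
Qed.

Lemma tlift_is_linear : linear (tlift b).
Proof.
by move=> c s t; rewrite -[s]treprK -[t]treprK -linearP !tlift_pi linearP.
Qed.

Lemma tlift_tens u v : tlift b (tens u v) = b u v.
Proof. by rewrite tensE tlift_pi freeliftU scale1r. Qed.

Lemma tlift_unique (f : tensor -> W) : linear f ->
  (forall u v, f (tens u v) = b u v) -> f =1 tlift b.
Proof.
move=> fl fE.
have f0 : f 0 = 0.
  by have := fl (- 1) 0 0; rewrite !scaleN1r oppr0 addr0 addNr.
have l0 : tlift b 0 = 0.
  have := tlift_is_linear (- 1) 0 0.
  by rewrite !scaleN1r oppr0 addr0 addNr.
elim/tens_ind => [|u v t IHt]; first by rewrite f0 l0.
rewrite -[tens u v]scale1r fl tlift_is_linear -/(tlift b) IHt.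
by rewrite fE tlift_tens.
Qed.

End Lift.

End Tensor.

Notation "u \ox v" := (tens u v)
  (at level 35, right associativity, format "u  \ox  v") : ring_scope.

Section TensorAlg.
Context (F : fieldType) (E A : assocAlg F).
Implicit Types (u v : E) (a b : A).

Fact tmul_key : unit. Proof. by []. Qed.

Definition tmul := locked_with tmul_key (fun s t =>
  tlift (fun (u : E) (a : A) =>
    tlift (fun (v : E) (b : A) => (u * v) \ox (a * b)) t) s).

Lemma tmulE s t : tmul s t =
  tlift (fun u a => tlift (fun v b => (u * v) \ox (a * b)) t) s.
Proof. by rewrite /tmul unlock. Qed.

Lemma tmul_inner_bilinear u a :
  is_bilinear (fun v b => (u * v) \ox (a * b)).
Proof.
split=> [b c v v'|v c b b'].
  by rewrite mulrDr algZr tens_linearl.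
by rewrite mulrDr algZr linearP.
Qed.

Lemma tmul_outer_bilinear t :
  is_bilinear (fun u a => tlift (fun v b => (u * v) \ox (a * b)) t).
Proof.
have tl u a := tlift_is_linear (tmul_inner_bilinear u a).
have t0 u a : tlift (fun v b => (u * v) \ox (a * b)) 0 = 0.
  by have := tl u a (- 1) 0 0; rewrite !scaleN1r oppr0 addr0 addNr.
split=> [a c u u'|u c a a']; elim/tens_ind: t => [|v b t IHt].
- by rewrite !t0 scaler0 addr0.
- rewrite -[v \ox b]scale1r !tl !(tlift_tens (tmul_inner_bilinear _ _)) IHt.
  rewrite !scale1r mulrDl algZl tens_linearl scalerDr.
  by rewrite -!addrA; congr (_ + _); rewrite addrCA.
- by rewrite !t0 scaler0 addr0.
- rewrite -[v \ox b]scale1r !tl !(tlift_tens (tmul_inner_bilinear _ _)) IHt.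
  rewrite !scale1r mulrDl algZl linearP scalerDr.
  by rewrite -!addrA; congr (_ + _); rewrite addrCA.
Qed.

Lemma tmul_tens u v a b : tmul (u \ox a) (v \ox b) = (u * v) \ox (a * b).
Proof.
rewrite tmulE (tlift_tens (tmul_outer_bilinear _)).
by rewrite (tlift_tens (tmul_inner_bilinear _ _)).
Qed.

Lemma tmul_tensl u a t :
  tmul (u \ox a) t = tlift (fun v b => (u * v) \ox (a * b)) t.
Proof. by rewrite tmulE (tlift_tens (tmul_outer_bilinear _)). Qed.

Lemma tmul_linearl c s s' t :
  tmul (c *: s + s') t = c *: tmul s t + tmul s' t.
Proof. by rewrite !tmulE (tlift_is_linear (tmul_outer_bilinear t)). Qed.

Lemma tmulDl s s' t : tmul (s + s') t = tmul s t + tmul s' t.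
Proof. by have := tmul_linearl 1 s s' t; rewrite !scale1r. Qed.

Lemma tmul0 t : tmul 0 t = 0.
Proof. by apply: (addrI (tmul 0 t)); rewrite -tmulDl !addr0. Qed.

Lemma tmul_bilinear : is_bilinear tmul.
Proof.
split=> [t c s s'|s c t t']; first exact: tmul_linearl.
elim/tens_ind: s => [|u a s IHs]; first by rewrite !tmul0 scaler0 addr0.
rewrite !tmulDl {}IHs !tmul_tensl.
rewrite (tlift_is_linear (tmul_inner_bilinear u a)) scalerDr.
by rewrite -!addrA; congr (_ + _); rewrite addrCA.
Qed.

Lemma tmulDr s t t' : tmul s (t + t') = tmul s t + tmul s t'.
Proof. by have := tmul_bilinear.2 s 1 t t'; rewrite !scale1r. Qed.

Lemma tmulr0 s : tmul s 0 = 0.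
Proof. by apply: (addrI (tmul s 0)); rewrite -tmulDr !addr0. Qed.

Lemma tmulA : associative tmul.
Proof.
have A1 u a v b t : tmul (u \ox a) (tmul (v \ox b) t) =
    tmul (tmul (u \ox a) (v \ox b)) t.
  elim/tens_ind: t => [|w c t IHt]; first by rewrite !tmulr0.
  rewrite (tmulDr (v \ox b) _ t) (tmulDr (u \ox a)) (tmulDr (tmul _ _) _ t) IHt.
  by rewrite !tmul_tens !mulrA.
have A2 u a s t : tmul (u \ox a) (tmul s t) = tmul (tmul (u \ox a) s) t.
  elim/tens_ind: s => [|v b s IHs]; first by rewrite tmul0 !tmulr0 tmul0.
  rewrite (tmulDl _ s) (tmulDr _ _ (tmul s t)) (tmulDr _ _ s) (tmulDl _ _ t).
  by rewrite A1 IHs.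
move=> r s t; elim/tens_ind: r => [|u a r IHr]; first by rewrite !tmul0.
by rewrite (tmulDl _ r) (tmulDl _ r s) (tmulDl _ _ t) IHr A2.
Qed.

Lemma tmul1 : left_id ((1 : E) \ox (1 : A)) tmul.
Proof.
move=> t; elim/tens_ind: t => [|u a t IHt]; first by rewrite tmulr0.
by rewrite (tmulDr _ _ t) IHt tmul_tens !mul1r.
Qed.

Lemma tmulr1 : right_id ((1 : E) \ox (1 : A)) tmul.
Proof.
move=> t; elim/tens_ind: t => [|u a t IHt]; first by rewrite tmul0.
by rewrite (tmulDl _ t) IHt tmul_tens !mulr1.
Qed.

Definition tensorAlg : assocAlg F :=
  AssocAlg tmul_bilinear tmulA tmul1 tmulr1.

End TensorAlg.

(* Elements of Z^2(G, F^x), G acting trivially on the unit group F^x of F. *)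
Record cocycle2 (G : groupType) (F : fieldType) := Cocycle2 {
  cocycle2_fun :> G -> G -> F;
  cocycle2_neq0 : forall g h, cocycle2_fun g h != 0;
  cocycle2P : forall g h k, cocycle2_fun g h * cocycle2_fun (g * h)%g k =
                            cocycle2_fun h k * cocycle2_fun g (h * k)%g
}.

Definition is_coboundary2 (G : groupType) (F : fieldType)
    (alpha : G -> G -> F) : Prop :=
  exists lam : G -> F, (forall g, lam g != 0) /\
    forall g h, alpha g h = lam g * lam h * (lam (g * h)%g)^-1.

Section TwistedGroupAlg.
Context (G : groupType) (F : fieldType) (alpha : cocycle2 G F).
Local Notation M := {malg F[G]}.
Implicit Types x y : M.

Fact twmul_key : unit. Proof. by []. Qed.

Definition twmul : M -> M -> M := locked_with twmul_key (fun x y =>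
  freelift (fun g => freelift (fun h => << alpha g h *g (g * h)%g >>) y) x).

(* As v_1 v_g = alpha(1, g) v_g = alpha(1, 1) v_g, the unit is not v_1 unless *)
(* alpha is normalized.                                                      *)
Definition twone : M := << (alpha 1%g 1%g)^-1 *g 1%g >>.

Lemma twmulE x y : twmul x y =
  freelift (fun g => freelift (fun h => << alpha g h *g (g * h)%g >>) y) x.
Proof. by rewrite /twmul unlock. Qed.

Lemma twmul_bilinear : is_bilinear twmul.
Proof.
split=> [y|x] c x1 x2; rewrite !twmulE ?linearP //.
elim/malg_ind: x => [|d g x IHx]; first by rewrite !linear0 addr0.
rewrite !linearP /= {}IHx !freeliftU !scale1r linearP /=.
rewrite !scalerDr !scalerA [d * c]mulrC.
exact: addrACA.
Qed.

Lemma twmulDl x x' y : twmul (x + x') y = twmul x y + twmul x' y.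
Proof. by have := twmul_bilinear.1 y 1 x x'; rewrite !scale1r. Qed.

Lemma twmulDr x y y' : twmul x (y + y') = twmul x y + twmul x y'.
Proof. by have := twmul_bilinear.2 x 1 y y'; rewrite !scale1r. Qed.

Lemma twmul0 y : twmul 0 y = 0.
Proof. by apply: (addrI (twmul 0 y)); rewrite -twmulDl !addr0. Qed.

Lemma twmulr0 x : twmul x 0 = 0.
Proof. by apply: (addrI (twmul x 0)); rewrite -twmulDr !addr0. Qed.

Lemma twmulU c d g h :
  twmul << c *g g >> << d *g h >> = << c * d * alpha g h *g (g * h)%g >>.
Proof.
rewrite twmulE !freeliftU scalerA [RHS]malgUZ -[RHS]scalerA.
by rewrite [in LHS]malgUZ.
Qed.

Lemma twmulUA a b c g h k :
  twmul << a *g g >> (twmul << b *g h >> << c *g k >>) =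
  twmul (twmul << a *g g >> << b *g h >>) << c *g k >>.
Proof.
rewrite !twmulU mulgA; congr << _ *g _ >>.
have := cocycle2P alpha g h k; set p := alpha g h; set q := alpha (g * h)%g k.
set r := alpha h k; set s := alpha g _ => e.
rewrite -[LHS]mulrA -[b * c * r * s]mulrA -e mulrACA -!mulrA.
by congr (_ * _); rewrite mulrCA; congr (_ * _); rewrite mulrCA.
Qed.

Lemma twmulA : associative twmul.
Proof.
have A1 a b g h z : twmul << a *g g >> (twmul << b *g h >> z) =
    twmul (twmul << a *g g >> << b *g h >>) z.
  elim/malg_ind: z => [|c k z IHz]; first by rewrite !twmulr0.
  rewrite -malgUZ (twmulDr << b *g h >> _ z) (twmulDr << a *g g >>).
  by rewrite (twmulDr (twmul _ _) _ z) IHz twmulUA.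
have A2 a g y z : twmul << a *g g >> (twmul y z) =
    twmul (twmul << a *g g >> y) z.
  elim/malg_ind: y => [|b h y IHy]; first by rewrite !(twmulr0, twmul0).
  rewrite -malgUZ (twmulDl _ y) (twmulDr _ _ (twmul y z)) (twmulDr _ _ y).
  by rewrite (twmulDl _ _ z) A1 IHy.
move=> x y z; elim/malg_ind: x => [|a g x IHx]; first by rewrite !twmul0.
by rewrite -malgUZ (twmulDl _ x) (twmulDl _ x y) (twmulDl _ _ z) IHx A2.
Qed.

Lemma cocycle2_1g g : alpha 1%g g = alpha 1%g 1%g.
Proof.
have := cocycle2P alpha 1%g 1%g g; rewrite !mul1g => /mulIf -> //.
exact: cocycle2_neq0.
Qed.

Lemma cocycle2_g1 g : alpha g 1%g = alpha 1%g 1%g.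
Proof.
have := cocycle2P alpha g 1%g 1%g; rewrite !mulg1 => /mulIf -> //.
exact: cocycle2_neq0.
Qed.

Lemma twmul1 : left_id twone twmul.
Proof.
move=> x; elim/malg_ind: x => [|c g x IHx]; first by rewrite twmulr0.
rewrite twmulDr IHx -malgUZ /twone twmulU cocycle2_1g mul1g mulrAC.
by rewrite mulVf ?mul1r ?cocycle2_neq0.
Qed.

Lemma twmulr1 : right_id twone twmul.
Proof.
move=> x; elim/malg_ind: x => [|c g x IHx]; first by rewrite twmul0.
rewrite twmulDl IHx -malgUZ /twone twmulU cocycle2_g1 mulg1 -mulrA.
by rewrite mulVf ?mulr1 ?cocycle2_neq0.
Qed.

Definition twistedGroupAlg : assocAlg F :=
  AssocAlg twmul_bilinear twmulA twmul1 twmulr1.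

Definition twbasis (g : G) : twistedGroupAlg := << g >>.

Lemma twbasisM g h : twbasis g * twbasis h = alpha g h *: twbasis (g * h)%g.
Proof. by rewrite [LHS]twmulU !mul1r [LHS]malgUZ. Qed.

Lemma twbasis1 : 1 = (alpha 1%g 1%g)^-1 *: twbasis 1%g.
Proof. by rewrite [LHS]malgUZ. Qed.

End TwistedGroupAlg.

Lemma coboundary2P (G : groupType) (F : fieldType) (beta : G -> G -> F) :
  is_coboundary2 beta -> exists alpha : cocycle2 G F, alpha =2 beta.
Proof.
move=> [lam [lam0 betaE]].
have b0 g h : beta g h != 0 by rewrite betaE !mulf_neq0 ?invr_eq0.
have bP g h k : beta g h * beta (g * h)%g k = beta h k * beta g (h * k)%g.
  rewrite !betaE mulgA !mulrA.
  set a := lam g; set b := lam h; set c := lam k.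
  have := lam0 (g * h)%g; have := lam0 (h * k)%g.
  set u := lam (g * h)%g; set w := lam (h * k)%g => w0 u0.
  congr (_ * _); rewrite mulfVK // [b * c / w * a]mulrAC mulfVK //.
  by rewrite -mulrA mulrC.
by exists (Cocycle2 b0 bP).
Qed.

Record grading (G : groupType) (F : fieldType) (A : assocAlg F) := Grading {
  gcomp :> G -> {pred A};
  gcomp0 : forall g, 0 \in gcomp g;
  gcompZD : forall g c x y,
    x \in gcomp g -> y \in gcomp g -> c *: x + y \in gcomp g;
  gcompM : forall g h x y,
    x \in gcomp g -> y \in gcomp h -> x * y \in gcomp (g * h)%g;
  gcomp_span : forall x, exists (s : seq G) (a : G -> A),
    [/\ uniq s, forall g, a g \in gcomp g & x = \sum_(g <- s) a g];
  gcomp_direct : forall (s : seq G) (a : G -> A),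
    uniq s -> (forall g, a g \in gcomp g) -> \sum_(g <- s) a g = 0 ->
    forall g, g \in s -> a g = 0
}.

Section BaseAlgebra.
Context (G : groupType) (F : fieldType) (A : assocAlg F) (Agr : grading G A).

Lemma gcompB g x y : x \in Agr g -> y \in Agr g -> x - y \in Agr g.
Proof. by move=> xg yg; rewrite addrC -scaleN1r gcompZD. Qed.

Lemma gcomp1 : 1 \in Agr 1%g.
Proof.
have [s0 [e0 [us0 e0P one_s0]]] := gcomp_span Agr 1.
pose s := undup (1%g :: s0); pose e h := if h \in s0 then e0 h else 0.
have us : uniq s by exact: undup_uniq.
have eP h : e h \in Agr h by rewrite /e; case: ifP => // _; exact: gcomp0.
have s1 : 1%g \in s by rewrite mem_undup inE eqxx.
have one_s : 1 = \sum_(h <- s) e h.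
  rewrite /e -big_mkcond -big_filter one_s0; apply: perm_big.
  apply: uniq_perm => [//||h]; first exact: filter_uniq.
  by rewrite mem_filter mem_undup inE; case: (h \in s0); rewrite ?orbT.
have e1 k x : x \in Agr k -> e 1%g * x = x.
  move=> xk; pose d h := (if h == 1%g then x else 0) - e h * x.
  have dP h : d h \in Agr (h * k)%g.
    apply: gcompB; last exact: gcompM.
    by case: eqP => [->|_]; rewrite ?mul1g // gcomp0.
  have sumd : \sum_(g <- [seq (h * k)%g | h <- s]) d (g * k^-1)%g = 0.
    rewrite big_map (eq_bigr d) => [|h _]; last by rewrite mulgK.
    rewrite sumrB -big_mkcond /= -mulr_suml -one_s mul1r.
    rewrite -big_filter filter_pred1_uniq // big_seq1.
    by rewrite subrr.
  have dkP g : d (g * k^-1)%g \in Agr g.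
    by have := dP (g * k^-1)%g; rewrite mulgVK.
  have usk : uniq [seq (h * k)%g | h <- s] by rewrite map_inj_uniq //; apply: mulIg.
  have ks : k \in [seq (h * k)%g | h <- s].
    by apply/mapP; exists 1%g; rewrite ?mul1g.
  have := gcomp_direct usk dkP sumd ks.
  by rewrite mulgV /d eqxx => /subr0_eq.
have <- : e 1%g = 1.
  rewrite -[LHS]mulr1 one_s mulr_sumr; apply: eq_bigr => h _.
  exact: e1 (eP h).
exact: eP.
Qed.

Definition base : Type := {x : A | x \in Agr 1%g}.

HB.instance Definition _ := [isSub of base for sval].
HB.instance Definition _ := [Choice of base by <:].

Lemma base_subring : subring_closed (Agr 1%g).
Proof.
split=> [|x y|x y xP yP]; first exact: gcomp1; first exact: gcompB.
by rewrite -[1%g]mulg1 gcompM.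
Qed.

HB.instance Definition _ :=
  GRing.SubChoice_isSubPzRing.Build A (Agr 1%g) base base_subring.

Definition base_incl : {rmorphism base -> A} := val.

End BaseAlgebra.

Section TwistedGradedAlg.
Context (G : groupType) (F : fieldType) (alpha : cocycle2 G F).
Context (A : assocAlg F) (Agr : grading G A).
Local Notation v := (twbasis alpha).
Local Notation T := (tensorAlg (twistedGroupAlg alpha) A).

(* The subspace \sum_g F v_g \ox A_g. *)
Definition twist_pred : {pred T} := fun t => `[< exists s : seq (F * G * A),
  (forall i, i \in s -> i.2 \in Agr i.1.2) /\
  t = \sum_(i <- s) (i.1.1 *: v i.1.2) \ox i.2 >].

Lemma twist_predU c g a : a \in Agr g -> (c *: v g) \ox a \in twist_pred.
Proof.
move=> ag; apply/asboolP; exists [:: (c, g, a)].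
by rewrite big_seq1; split=> // i; rewrite inE => /eqP ->.
Qed.

Lemma twist_pred0 : 0 \in twist_pred.
Proof. by apply/asboolP; exists [::]; rewrite big_nil. Qed.

Lemma twist_predD s t :
  s \in twist_pred -> t \in twist_pred -> s + t \in twist_pred.
Proof.
move=> /asboolP[p [pP ->]] /asboolP[q [qP ->]]; apply/asboolP; exists (p ++ q).
rewrite big_cat; split=> // i; rewrite mem_cat => /orP[/pP|/qP] //.
Qed.

Lemma twist_pred_sum (I : eqType) (r : seq I) (f : I -> T) :
  (forall i, i \in r -> f i \in twist_pred) -> \sum_(i <- r) f i \in twist_pred.
Proof.
move=> fP; rewrite big_seq; apply: (big_ind (fun t => t \in twist_pred)) => //.
- exact: twist_pred0.
- by move=> s t; exact: twist_predD.
Qed.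

Lemma tensorAlgM (u w : twistedGroupAlg alpha) (a b : A) :
  (u \ox a : T) * (w \ox b : T) = (u * w) \ox (a * b).
Proof. exact: tmul_tens. Qed.

Lemma twist_predN t : t \in twist_pred -> - t \in twist_pred.
Proof.
move=> /asboolP[p [pP ->]]; rewrite -sumrN; apply: twist_pred_sum => i /pP ip.
by rewrite -linearN twist_predU // -scaleN1r -[_ *: _]addr0 gcompZD ?gcomp0.
Qed.

Lemma twist_predM s t :
  s \in twist_pred -> t \in twist_pred -> s * t \in twist_pred.
Proof.
move=> /asboolP[p [pP ->]] /asboolP[q [qP ->]].
rewrite mulr_suml; apply: twist_pred_sum => i /pP ip.
rewrite mulr_sumr; apply: twist_pred_sum => j /qP jp.
rewrite tensorAlgM algZl algZr twbasisM !scalerA.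
exact/twist_predU/gcompM.
Qed.

Lemma twist_pred_base a : a \in Agr 1%g ->
  (1 : twistedGroupAlg alpha) \ox a \in twist_pred.
Proof. by rewrite twbasis1; exact: twist_predU. Qed.

Lemma twist_subring : subring_closed twist_pred.
Proof.
split=> [|s t sP tP|]; last exact: twist_predM.
  exact/twist_pred_base/gcomp1.
exact/twist_predD/twist_predN.
Qed.

Definition twist : Type := {t : T | t \in twist_pred}.

HB.instance Definition _ := [isSub of twist for sval].
HB.instance Definition _ := [Choice of twist by <:].
HB.instance Definition _ :=
  GRing.SubChoice_isSubPzRing.Build T twist_pred twist twist_subring.

Definition twist_base_fun (x : base Agr) : twist :=
  exist _ ((1 : twistedGroupAlg alpha) \ox val x) (twist_pred_base (valP x)).

Lemma twist_base_zmod : zmod_morphism twist_base_fun.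
Proof. by move=> x y; apply: val_inj; rewrite /= linearB. Qed.

Lemma twist_base_monoid : monoid_morphism twist_base_fun.
Proof.
split; first exact: val_inj.
by move=> x y; apply: val_inj; rewrite /= [RHS]tensorAlgM mul1r.
Qed.

HB.instance Definition _ :=
  GRing.isZmodMorphism.Build (base Agr) twist twist_base_fun twist_base_zmod.
HB.instance Definition _ :=
  GRing.isMonoidMorphism.Build (base Agr) twist twist_base_fun
    twist_base_monoid.

Lemma twist_base_inj : injective twist_base_fun.
Proof.
pose b (u : twistedGroupAlg alpha) (a : A) : A := (u : {malg F[G]})@_1%g *: a.
have bb : is_bilinear b.
  split=> [a c u u'|u c a a']; rewrite /b.
    by rewrite [_@__]mcoeffD mcoeffZ scalerDl scalerA.
  by rewrite scalerDr !scalerA mulrC.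
move=> x y /(congr1 (fun t : twist => tlift b (val t))).
rewrite /= !(tlift_tens bb) /b mcoeffUU => /(scalerI _) xy.
by apply/val_inj/xy; rewrite invr_eq0 cocycle2_neq0.
Qed.

Definition twist_base_incl : {rmorphism base Agr -> twist} := twist_base_fun.

End TwistedGradedAlg.

Section Restriction.
Context (R S : pzRingType) (f : {rmorphism R -> S}).

Definition restr (N : lmodType S) : Type := N.

Section Instances.
Context (N : lmodType S).

HB.instance Definition _ := GRing.Zmodule.on (restr N).

Definition restr_scale (r : R) (x : restr N) : restr N := f r *: (x : N).

Lemma restr_scaleA r s x :
  restr_scale r (restr_scale s x) = restr_scale (r * s) x.
Proof. by rewrite /restr_scale scalerA rmorphM. Qed.

Lemma restr_scale1 : left_id 1 restr_scale.
Proof. by move=> x; rewrite /restr_scale rmorph1 scale1r. Qed.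

Lemma restr_scaleDr : right_distributive restr_scale +%R.
Proof. by move=> r x y; exact: scalerDr. Qed.

Lemma restr_scaleDl x : {morph restr_scale^~ x : r s / r + s}.
Proof. by move=> r s; rewrite /restr_scale rmorphD scalerDl. Qed.

HB.instance Definition _ := GRing.Zmodule_isLmodule.Build R (restr N)
  restr_scaleA restr_scale1 restr_scaleDr restr_scaleDl.

End Instances.

(* Being the restriction of N is read up to isomorphism of R-modules; as N     *)
(* ranges over all S-modules, this amounts to the R-action on M itself         *)
(* extending along f to an action of S.                                        *)
Definition restricted_from (M : lmodType R) : Prop :=
  exists (N : lmodType S) (phi : {linear M -> restr N}), bijective phi.

End Restriction.

(* Main.v *)
Require Import Defs.
From HB Require Import structures.
From mathcomp Require Import all_boot all_algebra.
From mathcomp Require Import boolp.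
From mathcomp.multinomials Require Import monalg.

(** Write alpha(g, h) = lam_g lam_h / lam_gh.  The function lam is precisely
    what is needed to make v_g |-> lam_g an algebra character chi of the
    twisted group algebra, because v_g v_h = alpha(g, h) v_gh.  Hence chi
    tensored with the identity of A is a ring morphism from the whole tensor
    product to A.  Starting from it, rather than from the assignment
    a_g |-> lam_g^-1 v_g (x) a_g in the other direction, has the advantage that
    neither its definition nor its multiplicativity involves a choice of
    homogeneous decompositions.

    Its restriction [untwist] to alpha(A_G) sends v_g (x) a_g to lam_g a_g.
    It is surjective because the homogeneous components span A and lam_g is
    invertible, and injective because they are independent
    ([untwist_bij]).  It fixes the base algebra pointwise ([untwist_base]),
    since chi(1) = 1.

    So alpha(A_G) and A_G are isomorphic as rings under A_e, and scalars can be
    pulled back along the isomorphism and along its inverse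
    ([restricted_from_factor]). *)

Set Implicit Arguments.
Unset Strict Implicit.
Unset Printing Implicit Defensive.

Import GRing.Theory.

Local Open Scope ring_scope.

(** The scalar action on [restr N] depends on f, which does not occur in that
    type; here it is recorded. *)
Definition restr_lmod (R S : pzRingType) (f : {rmorphism R -> S})
  (N : lmodType S) : lmodType R := Defs_restr__canonical__GRing_Lmodule f N.

(** A module over S' is a module over S by pulling back along h, and this does
    not change the underlying R-module. *)
Lemma restricted_from_factor (R S S' : pzRingType) (f : {rmorphism R -> S})
    (f' : {rmorphism R -> S'}) (h : {rmorphism S -> S'}) (M : lmodType R) :
  (forall r, h (f r) = f' r) -> restricted_from f' M -> restricted_from f M.
Proof.
move=> hf [N [phi phi_bij]].
pose Nh := restr_lmod h N.
pose psi : M -> restr_lmod f Nh := phi.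
have psi_linear : linear psi.
  move=> r x y; rewrite /psi linearP.
  by congr (_ + _); rewrite /GRing.scale /= /restr_scale /= -hf.
pose psiL : {linear M -> restr_lmod f Nh} :=
  HB.pack psi (GRing.isLinear.Build R M (restr_lmod f Nh) *:%R psi psi_linear).
by exists Nh, psiL.
Qed.

Section TensorScale.
Context (F : fieldType) (U V : lmodType F).

Lemma tens0l (v : V) : (0 : U) \ox v = 0.
Proof.
apply: (addrI (0 \ox v)).
by rewrite -[X in X + _]scale1r -tens_linearl scale1r !addr0.
Qed.

Lemma tensZ c (u : U) (v : V) : (c *: u) \ox v = u \ox (c *: v).
Proof. by rewrite -[c *: u]addr0 tens_linearl tens0l addr0 linearZ. Qed.

End TensorScale.

Section Untwist.
Context (G : groupType) (F : fieldType) (alpha : cocycle2 G F).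
Context (A : assocAlg F) (Agr : grading G A).
Context (lam : G -> F) (lam_neq0 : forall g, lam g != 0).
Context (alphaE : forall g h, alpha g h = lam g * lam h * (lam (g * h)%g)^-1).

Local Notation E := (twistedGroupAlg alpha).
Local Notation T := (tensorAlg E A).
Local Notation v := (twbasis alpha).

Definition twchar (u : E) : F := freelift (lam : G -> F^o) u.

Lemma twchar_linear c u w : twchar (c *: u + w) = c * twchar u + twchar w.
Proof. exact: (linearP (freelift (lam : G -> F^o))). Qed.

Lemma twcharD u w : twchar (u + w) = twchar u + twchar w.
Proof. by rewrite -[u]scale1r twchar_linear mul1r scale1r. Qed.

Lemma twchar0 : twchar 0 = 0.
Proof. exact: (linear0 (freelift (lam : G -> F^o))). Qed.

Lemma twcharZ c u : twchar (c *: u) = c * twchar u.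
Proof. by rewrite -[c *: u]addr0 twchar_linear twchar0 addr0. Qed.

Lemma twchar_basis g : twchar (v g) = lam g.
Proof. by rewrite /twchar /twbasis freeliftU scale1r. Qed.

(** The unit is v_1 / alpha(1, 1), and the coboundary formula gives
    alpha(1, 1) = lam_1. *)
Lemma twchar1 : twchar 1 = 1.
Proof.
rewrite twbasis1 twcharZ twchar_basis alphaE mulg1 mulfK //.
by rewrite mulVf.
Qed.

(** By bilinearity this is a statement about basis elements, where it reads
    alpha(g, h) lam_gh = lam_g lam_h. *)
Lemma twcharM u w : twchar (u * w) = twchar u * twchar w.
Proof.
elim/malg_ind: u => [|c g u IHu]; first by rewrite mul0r twchar0 mul0r.
rewrite -[<< g >>]/(v g) mulrDl !twcharD mulrDl {}IHu; congr (_ + _).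
rewrite algZl !twcharZ -mulrA; congr (_ * _).
elim/malg_ind: w => [|d h w IHw]; first by rewrite mulr0 twchar0 mulr0.
rewrite -[<< h >>]/(v h) mulrDr !twcharD mulrDr {}IHw; congr (_ + _).
rewrite algZr !twcharZ twbasisM twcharZ !twchar_basis alphaE.
by rewrite mulfVK // mulrCA.
Qed.

Lemma twchar_scale_bilinear : is_bilinear (fun u (a : A) => twchar u *: a).
Proof.
split=> [a c u w|u c a b]; first by rewrite twchar_linear scalerDl scalerA.
by rewrite scalerDr !scalerA mulrC.
Qed.

Definition untwist_tensor : T -> A := tlift (fun u (a : A) => twchar u *: a).

Lemma untwist_tensor_linear c s t :
  untwist_tensor (c *: s + t) = c *: untwist_tensor s + untwist_tensor t.
Proof. exact: (tlift_is_linear twchar_scale_bilinear). Qed.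

HB.instance Definition _ :=
  GRing.isLinear.Build F T A *:%R untwist_tensor untwist_tensor_linear.

Lemma untwist_tensorD s t :
  untwist_tensor (s + t) = untwist_tensor s + untwist_tensor t.
Proof. exact: (linearD untwist_tensor). Qed.

Lemma untwist_tensorE u a : untwist_tensor (u \ox a) = twchar u *: a.
Proof. exact: (tlift_tens twchar_scale_bilinear). Qed.

Lemma untwist_tensorM s t :
  untwist_tensor (s * t) = untwist_tensor s * untwist_tensor t.
Proof.
elim/tens_ind: s t => [t|u a s IHs t]; first by rewrite mul0r linear0 mul0r.
rewrite mulrDl !untwist_tensorD mulrDl {}IHs; congr (_ + _).
elim/tens_ind: t => [|w b t IHt]; first by rewrite mulr0 linear0 mulr0.
rewrite mulrDr !untwist_tensorD mulrDr {}IHt; congr (_ + _).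
by rewrite tensorAlgM !untwist_tensorE algZl algZr scalerA twcharM.
Qed.

Definition untwist (t : twist alpha Agr) : A := untwist_tensor (val t).

Lemma untwist_zmod : zmod_morphism untwist.
Proof.
move=> s t; rewrite /untwist [val _](raddfB val).
exact: (linearB untwist_tensor).
Qed.

Lemma untwist_monoid : monoid_morphism untwist.
Proof.
split=> [|s t]; last by rewrite /untwist rmorphM untwist_tensorM.
by rewrite /untwist rmorph1 untwist_tensorE twchar1 scale1r.
Qed.

HB.instance Definition _ :=
  GRing.isZmodMorphism.Build (twist alpha Agr) A untwist untwist_zmod.
HB.instance Definition _ :=
  GRing.isMonoidMorphism.Build (twist alpha Agr) A untwist untwist_monoid.

Lemma untwist_base x : untwist (twist_base_incl alpha Agr x) = base_incl Agr x.
Proof. by rewrite /untwist untwist_tensorE twchar1 scale1r. Qed.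

Lemma gcompZ g c x : x \in Agr g -> c *: x \in Agr g.
Proof. by move=> xg; rewrite -[c *: x]addr0 gcompZD ?gcomp0. Qed.

(** Membership in [twist_pred] provides a sum in which a degree may occur
    several times; the independence of the components applies only after the
    terms of equal degree have been collected. *)
Lemma twist_predP (t : T) : t \in twist_pred (alpha := alpha) Agr ->
  exists (s : seq G) (a : G -> A),
    [/\ uniq s, forall g, a g \in Agr g & t = \sum_(g <- s) v g \ox a g].
Proof.
move=> /asboolP[p [pP ->]].
pose s := undup [seq i.1.2 | i <- p].
exists s, (fun g => \sum_(i <- p | i.1.2 == g) i.1.1 *: i.2).
split=> [|g|]; first exact: undup_uniq.
  rewrite big_seq_cond; apply: (big_ind (fun a : A => a \in Agr g)).
  - exact: gcomp0.
  - by move=> x y xg yg; rewrite -[x]scale1r gcompZD.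
  - by move=> i /andP[/pP ip /eqP <-]; exact: gcompZ.
rewrite (eq_bigr (fun g => \sum_(i <- p | i.1.2 == g) v g \ox (i.1.1 *: i.2)));
  last by move=> g _; rewrite linear_sum.
rewrite (exchange_big_dep xpredT) //= big_seq [RHS]big_seq.
apply: eq_bigr => i ip; rewrite -big_filter.
rewrite (eq_filter (a2 := pred1 i.1.2)) => [|g]; last by rewrite /= eq_sym.
have i_s : i.1.2 \in s by rewrite mem_undup; apply/mapP; exists i.
rewrite (filter_pred1_uniq (undup_uniq _) i_s) big_seq1.
exact: tensZ.
Qed.

Lemma untwist_tensor_sum (s : seq G) (a : G -> A) :
  untwist_tensor (\sum_(g <- s) v g \ox a g) = \sum_(g <- s) lam g *: a g.
Proof.
rewrite linear_sum; apply: eq_bigr => g _.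
by rewrite /= untwist_tensorE twchar_basis.
Qed.

(** A sum of terms v_g (x) a_g of distinct degrees is sent to the sum of the
    lam_g a_g; if the latter is 0, so is each of its homogeneous terms, hence
    each a_g. *)
Lemma untwist_inj : injective untwist.
Proof.
apply: raddf_inj => t untwist_t0; apply: val_inj; rewrite raddf0 /=.
have [s [a [us aP tE]]] := twist_predP (valP t).
have sum0 : \sum_(g <- s) lam g *: a g = 0.
  by rewrite -untwist_tensor_sum -tE.
have lamaP g : lam g *: a g \in Agr g by exact: gcompZ.
rewrite tE big_seq big1 // => g gs.
have := gcomp_direct us lamaP sum0 gs.
by move/(canRL (scalerK (lam_neq0 g))) ->; rewrite scaler0 linear0.
Qed.

Lemma untwist_surj x : exists t, untwist t = x.
Proof.
have [s [a [_ aP ->]]] := gcomp_span Agr x.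
pose t : T := \sum_(g <- s) v g \ox ((lam g)^-1 *: a g).
have tP : t \in twist_pred (alpha := alpha) Agr.
  apply: twist_pred_sum => g _; rewrite -tensZ.
  exact: twist_predU.
exists (exist _ t tP); rewrite /untwist untwist_tensor_sum.
by apply: eq_bigr => g _; rewrite scalerA mulfV ?scale1r.
Qed.

Lemma untwist_bij : bijective untwist.
Proof.
have [twisting twistingK] := choice untwist_surj.
exists twisting => // t; apply: untwist_inj; exact: twistingK.
Qed.

(** The morphism [untwist] and its inverse both commute with the inclusions of
    the base algebra, so each yields one implication. *)
Lemma restricted_from_twistE (M : lmodType (base Agr)) :
  restricted_from (twist_base_incl alpha Agr) M <->
  restricted_from (base_incl Agr) M.
Proof.
have [twisting untwistK twistingK] := untwist_bij.
pose twisting_zmod := can2_zmod_morphism untwistK twistingK.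
pose twisting_monoid := can2_monoid_morphism untwistK twistingK.
pose tw : {rmorphism A -> twist alpha Agr} := HB.pack twisting
  (GRing.isZmodMorphism.Build A (twist alpha Agr) twisting twisting_zmod)
  (GRing.isMonoidMorphism.Build A (twist alpha Agr) twisting twisting_monoid).
split; last exact: (restricted_from_factor (h := untwist)) untwist_base.
apply: (restricted_from_factor (h := tw)) => x.
by rewrite -untwist_base; exact: untwistK.
Qed.

End Untwist.

Theorem proposition6p1 (G : groupType) (F : fieldType) (A : assocAlg F)
    (Agr : grading G A) (M : lmodType (base Agr))
    (alpha : cocycle2 G F) (alphaB : is_coboundary2 alpha) :
  restricted_from (twist_base_incl alpha Agr) M <->
  restricted_from (base_incl Agr) M.
Proof.
by case: alphaB => lam [lam_neq0 alphaE]; exact: restricted_from_twistE alphaE M.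
Qed.
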